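(* Let $P$ be a loop-free pasting scheme. Then the function $T\colon X\mapsto R(\cup X)$ is an isomorphism between the $\omega$-categories $\mathrm{Cell}(P)$ and $\mathrm{WF}(P)$. Moreover, $T(\langle x\rangle)=R(x)$ for all $x\in P$.
   Context: An $\omega$-hypergraph is a set $P$ with a partition $P=\bigsqcup_{n\in\mathbb{N}}P_n$ together with, for $n\in\mathbb{N}$ and $u\in P_{n+1}$, two finite subsets $u^-,u^+\subseteq P_n$. For $U\subseteq P$ and $\epsilon\in\{-,+\}$, $U^\epsilon=\bigcup_{u\in U}u^\epsilon$; also $U^\mp=U^-\setminus U^+$ and $U^\pm=U^+\setminus U^-$. A subset $U\subseteq P_n$ is fork-free if either $n=0$ and $|U|=1$, or $n>0$ and $u^\epsilon\cap v^\epsilon=\emptyset$ for all distinct $u,v\in U$ and all $\epsilon\in\{-,+\}$. For $U\subseteq P_n$, $\triangleleft_U$ is the transitive closure of the relation on $U$ relating $u$ to $v$ when $n\ge 1$ and $u^+\cap v^-\neq\emptyset$; a subset $V\subseteq U$ is a segment for $\triangleleft_U$ if $u_1,u_3\in V$ and $u_1\triangleleft_U u_2\triangleleft_U u_3$ imply $u_2\in V$. $u\triangleleft v$ means $u\triangleleft_{P_n}v$ for some $n\geq 1$. An $n$-pre-cell of $P$ is a tuple $X=(X_{0,-},X_{0,+},\ldots,X_{n-1,-},X_{n-1,+},X_n)$ of finite subsets $X_{i,\epsilon}\subseteq P_i$, $X_n\subseteq P_n$; one writes $X_{n,-}=X_{n,+}=X_n$. For $i<n$, $\partial^\epsilon_i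 X=(X_{0,-},X_{0,+},\ldots,X_{i-1,-},X_{i-1,+},X_{i,\epsilon})$. A finite set $M\subseteq P_{i+1}$ moves a finite $U\subseteq P_i$ to a finite $V\subseteq P_i$ if $U=(V\cup M^-)\setminus M^+$ and $V=(U\cup M^+)\setminus M^-$. An $n$-cell is an $n$-pre-cell such that $X_{i+1,\epsilon}$ moves $X_{i,-}$ to $X_{i,+}$ for $0\le i<n$, $\epsilon\in\{-,+\}$, and every $X_{i,\epsilon}$ ($0\le i\le n$) is fork-free. $\mathrm{Cell}(P)$ is the graded set of cells, with identities $\mathrm{id}^{n+1}(X)=(X_{0,-},X_{0,+},\ldots,X_{n-1,-},X_{n-1,+},X_n,X_n,\emptyset)$ and, for $i<n$ and $n$-cells $X,Y$ with $\partial^+_iX=\partial^-_iY$, composition $X\ast_iY=Z$ with $Z_{j,\epsilon}=X_{j,\epsilon}$ for $j<i$, $Z_{i,-}=X_{i,-}$, $Z_{i,+}=Y_{i,+}$, $Z_{j,\epsilon}=X_{j,\epsilon}\cup Y_{j,\epsilon}$ for $j>i$. For $u\in P_n$, the atom $\langle u\rangle$ is the $n$-pre-cell with $\langle u\rangle_{n,-}=\langle u\rangle_{n,+}=\{u\}$ and, for $j<n$, $\langle u\rangle_{j,-}=(\langle u\rangle_{j+1,-})^\mp$, $\langle u\rangle_{j,+}=(\langle u\rangle_{j+1,+})^\pm$. Pasting schemes: for a relation $A$ on a graded set $P$, $A^l_k=A\cap(P_l\times P_k)$, $A(x)=\{y\mid x\,A\,y\}$, $A(X)=\bigcup_{x\in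 X}A(x)$, and $AA'$ is the composite relation ($x\,AA'\,z$ iff $x\,A\,y\,A'\,z$ for some $y$). A pre-pasting scheme is a graded set $P=\bigsqcup_nP_n$ with relations $B,E$ on $P$ such that: $B(x),E(x)$ are finite for all $x$; $B^l_k=E^l_k=\emptyset$ for $l<k$; $B^k_k$ and $E^k_k$ are the identity relation on $P_k$; for $A\in\{B,E\}$, $k<l$, $u\in P_{l+1}$, $v\in P_k$: $u\,A^{l+1}_k\,v$ iff $u\,A^{l+1}_lB^l_k\,v$ and $u\,A^{l+1}_lE^l_k\,v$. It is regarded as an $\omega$-hypergraph via $u^-=B^{k+1}_k(u)$, $u^+=E^{k+1}_k(u)$ for $u\in P_{k+1}$. $R$ is the smallest reflexive transitive relation on $P$ with $B(x)\cup E(x)\subseteq R(x)$ for all $x$. An $n$-fgs is a tuple $(X_0,\ldots,X_n)$ of finite $X_k\subseteq P_k$, identified with its union (with $n$ part of the data); closed means $R(X)=X$. For an $(n+1)$-fgs $X$, $\partial^-_nX=X\setminus E(X_{n+1})$ and $\partial^+_nX=X\setminus B(X_{n+1})$ (as $n$-fgs's); $\partial^\epsilon_i$ for lower $i$ is obtained by iteration. An $n$-fgs $X$ is well-formed if $X$ is closed, $X_n$ is fork-free and, when $n>0$, $\partial^-_{n-1}X$ and $\partial^+_{n-1}X$ are well-formed. $\mathrm{WF}(P)$ is the graded set of well-formed fgs's, with source and target $\partial^\pm$, identities $(X_0,\ldots,X_n)\mapsto(X_0,\ldots,X_n,\emptyset)$, and composition $X\ast_iY=X\cup Y$ when $\partial^+_iX=\partial^-_iY$.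 For $u\in P_n$, $R(u)$ is regarded as an $n$-fgs; for an $n$-pre-cell $X$, $\cup X$ is the $n$-fgs $\bigcup_{i\le n}(X_{i,-}\cup X_{i,+})$. $P$ has a direct loop if either there are $n\geq1$ and $u,v\in P_n$ with $u\triangleleft v$ and $E(v)\cap B(u)\neq\emptyset$, or there is $w\in P$ with $E(w)\cap B(w)\neq\{w\}$. A loop-free pasting scheme is a pre-pasting scheme such that: (0) $B^{k+1}_k(u)\ne\emptyset$ and $E^{k+1}_k(u)\neq\emptyset$ for $u\in P_{k+1}$; (1) for $k\le l$, $A\in\{B,E\}$, $u\in P_{l+1}$, $v\in P_k$: if $u\,E^{l+1}_lA^l_k\,v$ then $u\,E^{l+1}_k\,v$ or $u\,B^{l+1}_lA^l_k\,v$; and if $u\,B^{l+1}_lA^l_k\,v$ then $u\,B^{l+1}_k\,v$ or $u\,E^{l+1}_lA^l_k\,v$; (2) $P$ has no direct loops; (3) $R(u)$ is well-formed for $u\in P$; (4) for $k<n$, $X\in\mathrm{WF}(P)_k$, $u\in P_n$: if $\partial^-_k(R(u))\subseteq X$ then $\langle u\rangle_{k,-}$ is a segment for $\triangleleft_{X_k}$, and if $\partial^+_k(R(u))\subseteq X$ then $\langle u\rangle_{k,+}$ is a segment for $\triangleleft_{X_k}$; (5) for $X\in\mathrm{WF}(P)_n$ and $u\in P_{n+1}$ with $\partial^-_n(R(u))\subseteq X$: $X\cap E(u)=\emptyset$, and for $y\in X$, if $B(u)\cap R(y)\ne\emptyset$ then $y\in B(u)$. For a loop-free pasting scheme, $\mathrm{Cell}(P)$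 is a strict $\omega$-category with the sources and targets $\partial^\epsilon_i$ of pre-cells, the identities $X\mapsto\mathrm{id}^{n+1}(X)$ and the compositions $X\ast_iY$ of cells, and $\mathrm{WF}(P)$ is a strict $\omega$-category with the sources and targets $\partial^\epsilon_i$ of fgs's, the identities $(X_0,\ldots,X_n)\mapsto(X_0,\ldots,X_n,\emptyset)$ and the compositions $X\ast_iY=X\cup Y$. *)

(* Defs.v *)
From Stdlib Require Import Relations.
From mathcomp Require Import all_boot.
From mathcomp Require Import all_classical.

Set Implicit Arguments.
Unset Strict Implicit.
Unset Printing Implicit Defensive.

Local Open Scope classical_set_scope.

Variant sign := Minus | Plus.

Definition opp (e : sign) : sign := if e is Minus then Plus else Minus.

(* The partition of [elt] into the P_n is given by [dim]; [B x] and [E x] are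
   the sets B(x) and E(x). *)
Record pasting_data := PastingData {
  elt :> Type;
  dim : elt -> nat;
  B : elt -> set elt;
  E : elt -> set elt
}.

Section PastingSchemes.
Variable P : pasting_data.
Implicit Types (u v w x y z : P) (U V M X : set P) (e : sign) (i k l n : nat).

Definition rel_of e : P -> set P := if e is Minus then @B P else @E P.

Definition stratum n : set P := [set x | dim x = n].

(* A^l_k *)
Definition lev (A : P -> set P) l k : P -> set P :=
  fun x => [set y | [/\ dim x = l, dim y = k & A x y]].

Definition rcomp (A A' : P -> set P) : P -> set P :=
  fun x => [set z | exists2 y, A x y & A' y z].

Definition im (A : P -> set P) X : set P := [set y | exists2 x, X x & A x y].

(* ** The underlying omega-hypergraph *)

(* u^- and u^+; empty when dim u = 0 *)
Definition face e u : set P := [set v | dim u = (dim v).+1 /\ rel_of e u v].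

Definition faces e U : set P := im (face e) U.

(* U^{-+} for e = Minus, U^{+-} for e = Plus *)
Definition outer e U : set P := faces e U `\` faces (opp e) U.

(* fork-freeness of U as a subset of P_n *)
Definition fork_free n U : Prop :=
  if n is 0 then exists x, U = [set x]
  else forall u v, U u -> U v -> u <> v ->
         forall e, face e u `&` face e v = set0.

(* The relation below U, for U contained in some P_n; it is empty for n = 0,
   since elements of dimension 0 have no faces. *)
Definition tri_step U u v : Prop :=
  [/\ U u, U v & face Plus u `&` face Minus v !=set0].

Definition tri_on U : P -> P -> Prop := clos_trans P (tri_step U).

Definition tri u v : Prop := exists2 n, 0 < n & tri_on (stratum n) u v.

Definition segment U V : Prop :=
  V `<=` U /\
  forall u1 u2 u3, V u1 -> V u3 -> tri_on U u1 u2 -> tri_on U u2 u3 -> V u2.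

(* ** Cells *)

(* An n-pre-cell (X_{0,-}, X_{0,+}, ..., X_{n-1,-}, X_{n-1,+}, X_n) is encoded
   as the family i, e |-> X_{i,e}, with X_{n,-} = X_{n,+} = X_n and with empty
   components above n, so that equality of tuples is equality of families. The
   dimension n is not determined by the family and is carried separately. *)
Definition family := nat -> sign -> set P.

Definition is_precell n (X : family) : Prop :=
  [/\ forall i e, i <= n -> finite_set (X i e) /\ X i e `<=` stratum i,
      X n Minus = X n Plus
    & forall i e, n < i -> X i e = set0].

Definition moves M U V : Prop :=
  U = (V `|` faces Minus M) `\` faces Plus M /\
  V = (U `|` faces Plus M) `\` faces Minus M.

Definition is_cell n (X : family) : Prop :=
  [/\ is_precell n X,
      forall i e, i < n -> moves (X i.+1 e) (X i Minus) (X i Plus)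
    & forall i e, i <= n -> fork_free i (X i e)].

Definition precell_bd e i (X : family) : family :=
  fun j e' => if j < i then X j e' else if j == i then X i e else set0.

(* id^{n+1}(X) for an n-pre-cell X; its component of index n+1 is empty *)
Definition precell_id n (X : family) : family :=
  fun j e => if j <= n then X j e else set0.

Definition precell_comp i (X Y : family) : family :=
  fun j e => if j < i then X j e
             else if j == i then (if e is Minus then X i Minus else Y i Plus)
             else X j e `|` Y j e.

(* <u>_{j,e} = iter (dim u - j) (outer e) {u} for j <= dim u *)
Definition atom u : family :=
  fun j e => if j <= dim u then iter (dim u - j) (outer e) [set u] else set0.

(* ** Finite graded subsets *)

Definition R x : set P := [set y | clos_refl_trans P (fun a b => B a b \/ E a b) x y].

Definition closed X : Prop := im R X = X.

(* An n-fgs is a subset of P; its component X_k is the intersection of X with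
   P_k, and n is carried separately. *)
Definition is_fgs n X : Prop := finite_set X /\ forall x, X x -> dim x <= n.

Definition level X k : set P := X `&` stratum k.

(* d^e_n X for an (n+1)-fgs X *)
Definition fgs_bd1 e n X : set P := X `\` im (rel_of (opp e)) (level X n.+1).

(* d^e_i X for an n-fgs X *)
Fixpoint fgs_bd e i n X : set P :=
  if n is m.+1 then (if i <= m then fgs_bd e i m (fgs_bd1 e m X) else X) else X.

Fixpoint well_formed n X : Prop :=
  [/\ is_fgs n X, closed X, fork_free n (level X n)
    & if n is m.+1 then well_formed m (fgs_bd1 Minus m X) /\
                        well_formed m (fgs_bd1 Plus m X)
      else True].

(* The union of an n-pre-cell *)
Definition cup n (X : family) : set P :=
  [set x | exists i e, i <= n /\ X i e x].

Definition T n (X : family) : set P := im R (cup n X).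

(* ** Loop-free pasting schemes *)

Definition is_pre_pasting_scheme : Prop :=
  [/\ forall e x, finite_set (rel_of e x),
      forall e l k, l < k -> forall x y, ~ lev (rel_of e) l k x y,
      forall e k x y, lev (rel_of e) k k x y <-> dim x = k /\ x = y
    & forall e k l u v, k < l -> dim u = l.+1 -> dim v = k ->
        lev (rel_of e) l.+1 k u v <->
        rcomp (lev (rel_of e) l.+1 l) (lev (@B P) l k) u v /\
        rcomp (lev (rel_of e) l.+1 l) (lev (@E P) l k) u v].

Definition has_direct_loop : Prop :=
  (exists n u v, [/\ 0 < n, dim u = n, dim v = n, tri u v
                   & E v `&` B u !=set0]) \/
  (exists w, E w `&` B w <> [set w]).

Definition is_loop_free_pasting_scheme : Prop :=
  is_pre_pasting_scheme /\
  [/\ (* (0) *)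
      forall e k u, dim u = k.+1 -> lev (rel_of e) k.+1 k u !=set0,
      (* (1) *)
      forall e k l u v, k <= l -> dim u = l.+1 -> dim v = k ->
        (rcomp (lev (@E P) l.+1 l) (lev (rel_of e) l k) u v ->
           lev (@E P) l.+1 k u v \/
           rcomp (lev (@B P) l.+1 l) (lev (rel_of e) l k) u v) /\
        (rcomp (lev (@B P) l.+1 l) (lev (rel_of e) l k) u v ->
           lev (@B P) l.+1 k u v \/
           rcomp (lev (@E P) l.+1 l) (lev (rel_of e) l k) u v),
      (* (2) and (3) *)
      ~ has_direct_loop /\ (forall u, well_formed (dim u) (R u)),
      (* (4) *)
      forall e k n X u, k < n -> well_formed k X -> dim u = n ->
        fgs_bd e k n (R u) `<=` X -> segment (level X k) (atom u k e)
    & (* (5) *)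
      forall n X u, well_formed n X -> dim u = n.+1 ->
        fgs_bd Minus n n.+1 (R u) `<=` X ->
        X `&` E u = set0 /\
        (forall y, X y -> B u `&` R y !=set0 -> B u y)].

End PastingSchemes.

(* ** Omega-categories *)

(* The structure carried by a strict omega-category C. The n-cells are the
   elements of [cells n], a subset of an ambient type; the operations are used
   only on the following arguments:
   - [bd e i n X] is the e-boundary of dimension i of an n-cell X, for i < n;
   - [idc n X] is the identity (n+1)-cell of an n-cell X;
   - [comp i n X Y] is the i-composite of n-cells X, Y with i < n and
     [bd Plus i n X = bd Minus i n Y].
   The axioms of strict omega-categories are not part of this record: an
   isomorphism only refers to the structure. *)
Record omega_structure := OmegaStructure {
  carrier : Type;
  cells : nat -> set carrier;
  bd : sign -> nat -> nat -> carrier -> carrier;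
  idc : nat -> carrier -> carrier;
  comp : nat -> nat -> carrier -> carrier -> carrier
}.

Arguments cells : clear implicits.
Arguments bd : clear implicits.
Arguments idc : clear implicits.
Arguments comp : clear implicits.

(* F is a graded bijection that preserves sources, targets, identities and
   compositions. *)
Definition is_omega_iso (C D : omega_structure)
    (F : nat -> carrier C -> carrier D) : Prop :=
  [/\ forall n, set_bij (cells C n) (cells D n) (F n),
      forall e i n X, i < n -> cells C n X ->
        F i (bd C e i n X) = bd D e i n (F n X),
      forall n X, cells C n X -> F n.+1 (idc C n X) = idc D n (F n X)
    & forall i n X Y, i < n -> cells C n X -> cells C n Y ->
        bd C Plus i n X = bd C Minus i n Y ->
        F n (comp C i n X Y) = comp D i n (F n X) (F n Y)].

Definition Cell (P : pasting_data) : omega_structure := {|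
  carrier := family P;
  cells := fun n => [set X | is_cell n X];
  bd := fun e i _ X => precell_bd e i X;
  idc := fun n X => precell_id n X;
  comp := fun i _ X Y => precell_comp i X Y
|}.

Definition WF (P : pasting_data) : omega_structure := {|
  carrier := set P;
  cells := fun n => [set X | well_formed n X];
  bd := fun e i n X => fgs_bd e i n X;
  idc := fun _ X => X;
  comp := fun _ _ X Y => X `|` Y
|}.

(* Main.v *)
Require Import Defs.
From Stdlib Require Import Relations.
From mathcomp Require Import all_boot.
From mathcomp Require Import all_classical.

Set Implicit Arguments.
Unset Strict Implicit.
Unset Printing Implicit Defensive.

Local Open Scope classical_set_scope.

(* A well-formed fgs X determines the family of the top levels of its iterated
   boundaries, [cell_of X]; this is a cell because
   d^e_i d^-_{i+1} X = d^e_i d^+_{i+1} X, and T (cell_of X) = X. It remains to see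
   that every cell is of this form. By induction its source is [cell_of D] for
   some well-formed D; if M is its top component, it is [cell_of] of
   D u E(M), with target (D u E(M)) \ B(M). The target is shown to be well-formed
   by attaching the elements u of M to D one by one along the acyclic relation:
   by (5), D n E(u) is empty and D \ B(u) is closed, and (1) shows that
   (D \ B(u)) u (E(u) \ {u}) is again well-formed, with the same boundaries as D.
   Finally R(u) is generated by its top element, and this purity passes to the
   boundaries, so that [cell_of (R u)] is the atom of u. *)

(** * Signs and induction over finite sets *)

Lemma oppK e : opp (opp e) = e.
Proof. by case: e. Qed.

(** Well-founded induction inside a finite set, by induction on an enumerating list [a :: s]: [Q a]
    is obtained first, from the elements below [a], and then serves for all the others. *)
Lemma finite_acyclic_ind (A : Type) (lt : A -> A -> Prop) (M : set A)
    (Q : A -> Prop) :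
    finite_set M -> (forall x, ~ lt x x) ->
    (forall x y z, lt x y -> lt y z -> lt x z) ->
    (forall x, M x -> (forall y, M y -> lt y x -> Q y) -> Q x) ->
  forall x, M x -> Q x.
Proof.
move=> finM irr tr.
have [s Ms] : exists s : seq {classic A}, M `<=` [set` s].
  by have /finite_seqP[s ->] : finite_set (M : set {classic A}) by []; exists s.
clear finM.
elim: s M Ms Q => [|a s IHs] M Ms Q step x Mx; first by have := Ms x Mx.
have below : forall (N : set A) (Q' : A -> Prop), N `<=` M -> ~ N a ->
    (forall z, N z -> (forall y, N y -> lt y z -> Q' y) -> Q' z) ->
    forall z, N z -> Q' z.
  move=> N Q' NM Na; apply: IHs => z Nz.
  have /= := Ms z (NM _ Nz); rewrite inE => /orP[/eqP za|//].
  by case: Na; rewrite -za.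
(* The elements below [a] do not include [a] by irreflexivity and are closed downwards in [M] by
   transitivity. *)
have Qa : M a -> Q a.
  move=> Ma; apply: (step) => // y My ya.
  apply: (below [set z | M z /\ lt z a] Q) => //; first by move=> z [].
    by case=> _ /irr.
  move=> z [Mz za] IH; apply: (step) => // w Mw wz.
  by apply: IH => //; split => //; exact: (tr _ _ _ wz za).
have [ax|ax] := pselect (a = x); first by rewrite -ax; apply: Qa; rewrite ax.
apply: (below [set z | M z /\ a <> z] Q) => //; first by move=> z [].
  by case.
move=> z [Mz az] IH; apply: (step) => // w Mw wz.
have [aw|aw] := pselect (a = w); last exact: IH.
by rewrite -aw; apply: Qa; rewrite aw.
Qed.

(** The induction is on a bound for the length of a list covering [M]; filtering out [x] makes the
    list strictly shorter. *)
Lemma finite_set_remove_ind (A : Type) (Q : set A -> Prop) :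
    (forall M, finite_set M -> (forall x, M x -> Q (M `\ x)) -> Q M) ->
  forall M, finite_set M -> Q M.
Proof.
move=> step M finM.
have [s Ms] : exists s : seq {classic A}, M `<=` [set` s].
  by have /finite_seqP[s ->] : finite_set (M : set {classic A}) by []; exists s.
have [k] := ubnP (size s); elim: k => // k IHk in s M finM Ms *.
rewrite ltnS => le_sk; apply: step => // x Mx.
apply: (IHk [seq y <- s | y != (x : {classic A})]).
- exact: finite_setD.
- move=> y [/Ms /= ys /= yx]; rewrite mem_filter ys andbT; exact/eqP.
- apply: leq_trans le_sk; rewrite size_filter -(count_predC (pred1 (x : {classic A})) s).
  by rewrite -[X in X < _]add0n ltn_add2r -has_count has_pred1; exact: Ms Mx.
Qed.

Section LoopFreePastingSchemes.
Variable P : pasting_data.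
Hypothesis hP : is_loop_free_pasting_scheme P.
Implicit Types (u v w x y z : P) (D M U V W X : set P).

(** * The axioms in terms of signs and faces *)

Lemma finite_rel e x : finite_set (rel_of e x).
Proof. by case: hP => -[]. Qed.

Lemma rel_dim e x y : rel_of e x y -> dim y <= dim x.
Proof.
case: hP => -[_ h _ _] _ exy; rewrite leqNgt; apply/negP => lt_xy.
exact: (h e _ _ lt_xy x y).
Qed.

Lemma rel_refl e x : rel_of e x x.
Proof. by case: hP => -[_ _ h _] _; have [_ /(_ (conj erefl erefl))[]] := h e (dim x) x x. Qed.

Lemma rel_dim_eq e x y : rel_of e x y -> dim y = dim x -> y = x.
Proof.
case: hP => -[_ _ h _] _ exy dyx.
by have [/(_ (And3 erefl dyx exy))[]] := h e (dim x) x y.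
Qed.

(** The composition axiom decomposes through both B and E, so [e] can be chosen independently of
    [d]. *)
Lemma rel_face d e u y : rel_of d u y -> (dim y).+1 < dim u ->
  exists2 z, face d u z & rel_of e z y.
Proof.
case: hP => -[_ _ _ h] _; case du: (dim u) => [//|l] duy yl.
have [/(_ (And3 du erefl duy))[hB hE] _] := h d (dim y) l u y yl du erefl.
case: e; [case: hB|case: hE] => z [_ zl uz] [_ _ zy]; exists z => //.
  by split=> //; rewrite du zl.
by split=> //; rewrite du zl.
Qed.

Lemma face_nonempty e u : 0 < dim u -> face e u !=set0.
Proof.
case: hP => _ [h _ _ _ _]; case du: (dim u) => [//|l] _.
by have [v [_ vl uv]] := h e l u du; exists v; split; rewrite // du vl.
Qed.

(** Axiom (1), its two halves merged by the sign [d]. *)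
Lemma face_swap d e u z y : face d u z -> rel_of e z y ->
  rel_of d u y \/ exists2 z', face (opp d) u z' & rel_of e z' y.
Proof.
case: hP => _ [_ h _ _ _] [du uz] zy.
have [h1 h2] := h e (dim y) (dim z) u y (rel_dim zy) du erefl.
have hz : rcomp (lev (rel_of d) (dim z).+1 (dim z))
                (lev (rel_of e) (dim z) (dim y)) u y by exists z.
case: d uz hz {h} => uz hz; [case: (h2 hz)|case: (h1 hz)].
- by case; left.
- by move=> [z' [_ z'l uz'] [_ _ z'y]]; right; exists z' => //; split; rewrite // du z'l.
- by case; left.
- by move=> [z' [_ z'l uz'] [_ _ z'y]]; right; exists z' => //; split; rewrite // du z'l.
Qed.

(** * Absence of direct loops and acyclicity *)

Lemma no_direct_loop : ~ has_direct_loop P.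
Proof. by case: hP => _ [_ _ []]. Qed.

Lemma wf_R u : well_formed (dim u) (R u).
Proof. by case: hP => _ [_ _ []]. Qed.

Lemma rel_opp_rel e u y : rel_of e u y -> rel_of (opp e) u y -> y = u.
Proof.
move=> h1 h2; have : (E u `&` B u) y by case: e h1 h2.
have [->//|loop] := pselect (E u `&` B u = [set u]).
by case: no_direct_loop; right; exists u.
Qed.

(** [meets Plus] is one step of the acyclic relation, [meets Minus] its converse. *)
Definition meets e u v := face e u `&` face (opp e) v !=set0.

Lemma clos_meets_dim u v : clos_trans P (meets Plus) u v -> dim u = dim v /\ 0 < dim u.
Proof.
elim=> [x y [z [[-> _] [-> _]]]|x y z _ [-> ?] _ [? _]] //.
Qed.

Lemma clos_meets_tri u v : clos_trans P (meets Plus) u v -> tri u v.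
Proof.
move=> uv; exists (dim u); first by have [] := clos_meets_dim uv.
elim: uv => [x y xy|x y z xy h1 yz h2].
  by apply: t_step; split=> //; have [] := clos_meets_dim (t_step _ _ _ _ xy).
by apply: t_trans h1 _; have [->] := clos_meets_dim xy.
Qed.

Lemma meets_no_loop u v : clos_trans P (meets Plus) u v ->
  E v `&` B u = set0.
Proof.
move=> uv; apply/eqP/negPn/negP => /set0P vu; apply: no_direct_loop; left.
have [duv u0] := clos_meets_dim uv.
by exists (dim u), u, v; split=> //; exact: clos_meets_tri.
Qed.

(** A cycle at [u] would be a direct loop, since [u] lies in both E(u) and B(u). *)
Lemma meets_acyclic u : ~ clos_trans P (meets Plus) u u.
Proof.
move=> /meets_no_loop; apply/eqP/set0P; exists u.
by split; [exact: (rel_refl Plus)|exact: (rel_refl Minus)].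
Qed.

(** Induction along the acyclic relation: [Q] is assumed for the successors of [u] in [M] if [e] is
    [Plus], for its predecessors if [e] is [Minus]. *)
Lemma meets_ind e M (Q : P -> Prop) : finite_set M ->
    (forall u, M u -> (forall v, M v -> meets e u v -> Q v) -> Q u) ->
  forall u, M u -> Q u.
Proof.
move=> finM step.
pose lt v u := if e is Minus then clos_trans P (meets Plus) v u
               else clos_trans P (meets Plus) u v.
apply: (@finite_acyclic_ind _ lt) => //.
- by move=> x; rewrite /lt; case: (e) => /meets_acyclic.
- by move=> x y z; rewrite /lt; case: (e) => h1 h2; apply: t_trans; eauto.
- move=> u Mu IH; apply: (step) => // v Mv uv; apply: IH => //.
  rewrite /lt; move: uv; case: (e) => uv; apply: t_step => //.
  by have [z [h1 h2]] := uv; exists z.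
Qed.

(** * The relation R and faces *)

Lemma finite_face e u : finite_set (face e u).
Proof. by apply: sub_finite_set (finite_rel e u) => y []. Qed.

Lemma face_dim0 e u y : dim u = 0 -> ~ face e u y.
Proof. by move=> u0 []; rewrite u0. Qed.

Lemma rel_R e u y : rel_of e u y -> R u y.
Proof. by move=> h; apply: rt_step; case: e h; [left|right]. Qed.

Lemma R_refl u : R u u.
Proof. exact: rt_refl. Qed.

Lemma R_trans u v w : R u v -> R v w -> R u w.
Proof. exact: rt_trans. Qed.

Lemma face_R e u y : face e u y -> R u y.
Proof. by case=> _; exact: rel_R. Qed.

Lemma rel_face_R e u y : rel_of e u y -> y <> u ->
  exists2 z, face e u z & R z y.
Proof.
move=> uy yu; have := rel_dim uy; rewrite leq_eqVlt => /orP[/eqP|].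
  by move/(rel_dim_eq uy).
rewrite leq_eqVlt => /orP[/eqP dy|/(rel_face Minus uy)[z uz zy]].
  by exists y; [split|exact: R_refl].
by exists z => //; exact: (@rel_R Minus).
Qed.

Lemma R_face u y : R u y -> y <> u -> exists e, exists2 z, face e u z & R z y.
Proof.
move=> /(clos_rt_rt1n P); elim=> [x //|x v w xv vw IH wx].
have [vx|vx] := pselect (v = x); first by rewrite -vx; apply: IH; rewrite vx.
have [e xv'] : exists e, rel_of e x v by case: xv; [exists Minus|exists Plus].
have [z xz zv] := rel_face_R xv' vx; exists e, z => //.
by apply: R_trans zv _; apply: clos_rt1n_rt.
Qed.

Lemma R_dim u y : R u y -> dim y <= dim u.
Proof.
elim=> [x w [|]|x //|x v w _ h1 _ h2]; last exact: leq_trans h1.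
- exact: (@rel_dim Minus).
- exact: (@rel_dim Plus).
Qed.

Lemma R_dim_eq u y : R u y -> dim y = dim u -> y = u.
Proof.
move=> uy dyu; apply: contrapT => /(R_face uy)[e [z [du _] /R_dim]].
by rewrite dyu du ltnn.
Qed.

(* If [y] is not in [A_e(u)] then, by (1), a face of sign [e] above [y] can be
   exchanged for one of the opposite sign, or for the next face of sign [e]
   along the acyclic relation. *)
Lemma R_rel_or_face e u y : R u y ->
  rel_of e u y \/ exists2 z, face (opp e) u z & R z y.
Proof.
move: {2}(dim u) (erefl (dim u)) => n; elim: n e u y => [|n IHn] e u y du uy.
  have [->|yu] := pselect (y = u); first by left; exact: rel_refl.
  by have [e' [z /(face_dim0 du)]] := R_face uy yu.
have [->|yu] := pselect (y = u); first by left; exact: rel_refl.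
(* A face of sign [opp e] above [y] is already the second alternative. *)
suff key : forall z, face e u z -> R z y ->
    rel_of e u y \/ exists2 z, face (opp e) u z & R z y.
  have [e' [z uz zy]] := R_face uy yu.
  case: e e' uz key {uy} => -[] uz key.
  - exact: key uz zy.
  - by right; exists z.
  - by right; exists z.
  - exact: key uz zy.
apply: (meets_ind (e := e) (Q := fun z => R z y -> _) (finite_face e u)) => z uz IHz zy.
have dz : dim z = n by case: uz => + _; rewrite du => -[].
have [zy'|] := IHn (opp e) z y dz zy.
  case: (face_swap uz zy') => [|[z' uz' z'y]]; [by left|right].
  by exists z' => //; exact: rel_R z'y.
rewrite oppK => -[z1 zz1 z1y].
have zz1r : rel_of e z z1 by case: zz1.
case: (face_swap uz zz1r) => [uz1|[z' uz' z'z1]]; last first.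
  by right; exists z' => //; apply: R_trans z1y; exact: rel_R z'z1.
(* Choosing the sign [opp e] here makes [w] the neighbour of [z] across [z1], so that the induction
   along [meets e] applies. *)
have [|w uw wz1] := rel_face (opp e) uz1.
  by case: zz1 => <- _; rewrite dz du.
have dw : dim w = n by case: uw => + _; rewrite du => -[].
apply: (IHz w) => //.
  exists z1; split=> //; split=> //.
  by case: zz1 => <- _; rewrite dz dw.
by apply: R_trans z1y; exact: rel_R wz1.
Qed.


(** * The family of boundaries of a well-formed fgs *)

Lemma closed_R X x y : Defs.closed X -> X x -> R x y -> X y.
Proof. by move=> cX Xx xy; rewrite -cX; exists x. Qed.

Lemma closed_rel e X x y : Defs.closed X -> X x -> rel_of e x y -> X y.
Proof. by move=> cX Xx /rel_R; exact: closed_R. Qed.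

Lemma closed_face e X x y : Defs.closed X -> X x -> face e x y -> X y.
Proof. by move=> cX Xx [_]; exact: closed_rel. Qed.

Lemma rel_closed X : (forall e x y, X x -> rel_of e x y -> X y) -> Defs.closed X.
Proof.
move=> h; apply/seteqP; split=> [y [x Xx xy]|x Xx]; last by exists x => //; exact: R_refl.
elim: xy Xx => [a b [] ab Xa|//|a b c _ h1 _ h2 /h1 //].
  exact: (h Minus) ab.
exact: (h Plus) ab.
Qed.

Lemma finite_im (A : P -> set P) X : finite_set X ->
  (forall x, X x -> finite_set (A x)) -> finite_set (im A X).
Proof.
move=> finX finA; apply: (@sub_finite_set _ _ (\bigcup_(x in X) A x)).
  by move=> y [x Xx xy]; exists x.
exact: bigcup_finite.
Qed.

Lemma wf_finite n X : well_formed n X -> finite_set X.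
Proof. by case: n => [|n] [[]]. Qed.

Lemma wf_dim n X x : well_formed n X -> X x -> dim x <= n.
Proof. by case: n => [|n] [[_ h] _ _ _]; exact: h. Qed.

Lemma wf_closed n X : well_formed n X -> Defs.closed X.
Proof. by case: n => [|n] []. Qed.

Lemma wf_fork_free n X : well_formed n X -> fork_free n (level X n).
Proof. by case: n => [|n] []. Qed.

Lemma wf_bd1 e n X : well_formed n.+1 X -> well_formed n (fgs_bd1 e n X).
Proof. by case: e => -[_ _ _ []]. Qed.

Lemma fgs_bdS e i n X : i <= n -> fgs_bd e i n.+1 X = fgs_bd e i n (fgs_bd1 e n X).
Proof. by move=> /= ->. Qed.

Lemma fgs_bd_id e n X : fgs_bd e n n X = X.
Proof. by case: n => //= n; rewrite ltnn. Qed.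

Lemma fgs_bd_bd1 e n X : fgs_bd e n n.+1 X = fgs_bd1 e n X.
Proof. by rewrite fgs_bdS // fgs_bd_id. Qed.

Lemma fgs_bd_sub e i n X : fgs_bd e i n X `<=` X.
Proof.
elim: n X => [|n IHn] X /=; first exact: subset_refl.
case: ifP => _; last exact: subset_refl.
by apply: subset_trans (IHn _) _; move=> x [].
Qed.

Lemma wf_bd e i n X : i <= n -> well_formed n X -> well_formed i (fgs_bd e i n X).
Proof.
elim: n X => [|n IHn] X; first by rewrite leqn0 => /eqP ->.
rewrite leq_eqVlt => /orP[/eqP-> |]; first by rewrite fgs_bd_id.
by rewrite ltnS => le_in /(wf_bd1 e) wfX; rewrite fgs_bdS //; exact: IHn.
Qed.

(** If [y] were in the part of sign [opp e] of a face [z] of sign [d] of a top element, [z] would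
    have to be missing from the [d]-boundary, hence be a face of sign [opp d] of a next top element.
    A swap there gives a new such [z], and acyclicity ends the chain. *)
Lemma fgs_bd1_sub e d n X : well_formed n.+2 X ->
  fgs_bd1 e n (fgs_bd1 d n.+1 X) `<=` fgs_bd1 e n (fgs_bd1 (opp d) n.+1 X).
Proof.
move=> wfX y [[Xy ndy] ney].
have cX := wf_closed wfX.
(* Each boundary removes its whole top level, as every element lies in its own B and E. *)
have ly : dim y <= n.
  have := wf_dim wfX Xy; rewrite leq_eqVlt => /orP[/eqP dy|].
    by case: ndy; exists y => //; exact: rel_refl.
  rewrite ltnS leq_eqVlt => /orP[/eqP dy|//].
  by case: ney; exists y => //; exact: rel_refl.
have fM : finite_set (level X n.+2).
  by apply: sub_finite_set (wf_finite wfX) => x [].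
have chain u : level X n.+2 u -> forall z, face d u z -> ~ rel_of (opp e) z y.
  apply: (meets_ind (e := d) fM
    (Q := fun u => forall z, face d u z -> ~ rel_of (opp e) z y)) => {}u Mu IH z uz zy.
  have [v Mv vz] : im (rel_of (opp d)) (level X n.+2) z.
    apply: contrapT => nz; apply: ney; exists z => //; split.
      by split=> //; case: Mu => Xu _; exact: closed_face uz.
    by case: uz; case: Mu => _ -> [].
  have fvz : face (opp d) v z.
    by split=> //; case: uz => <- _; case: Mu => _ ->; case: Mv.
  case: (face_swap fvz zy) => [vy|[w]]; first by apply: ndy; exists v.
  by rewrite oppK; apply: IH => //; exists z.
split.
  split=> // -[u Mu]; rewrite oppK => uy.
  have [|z uz zy] := rel_face (opp e) uy; first by case: Mu => _ ->.
  exact: (chain u Mu z uz zy).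
move=> [z [[Xz ndz] dz] zy].
have [[v Mv vz]|nz] := pselect (im (rel_of (opp d)) (level X n.+2) z).
  have fvz : face (opp d) v z by split=> //; case: Mv => _ ->; rewrite dz.
  case: (face_swap fvz zy) => [vy|[w]]; first by apply: ndy; exists v.
  by rewrite oppK => vw wy; exact: (chain v Mv w vw wy).
by apply: ney; exists z.
Qed.

(** Globularity: the inclusion above holds for [d] and for its opposite. *)
Lemma fgs_bd1_bd1 e d n X : well_formed n.+2 X ->
  fgs_bd1 e n (fgs_bd1 d n.+1 X) = fgs_bd1 e n (fgs_bd1 e n.+1 X).
Proof.
move=> wfX.
have key d' : fgs_bd1 e n (fgs_bd1 d' n.+1 X) = fgs_bd1 e n (fgs_bd1 (opp d') n.+1 X).
  by apply/seteqP; split; have := @fgs_bd1_sub e _ n X wfX; [|rewrite -{2}(oppK d')]; apply.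
have [->//|->] : d = e \/ d = opp e by case: d e {key} => -[]; auto.
by rewrite -key.
Qed.

Lemma fgs_bd_fgs_bd1 e d j n X : j < n -> well_formed n.+1 X ->
  fgs_bd e j n (fgs_bd1 d n X) = fgs_bd e j n.+1 X.
Proof.
case: n => // n jn wfX.
by rewrite [RHS]fgs_bdS 1?ltnW // !fgs_bdS // (fgs_bd1_bd1 e d wfX).
Qed.

Lemma fgs_bd_fgs_bd e d j i n X : j < i -> i <= n -> well_formed n X ->
  fgs_bd e j i (fgs_bd d i n X) = fgs_bd e j n X.
Proof.
move=> ji; elim: n X => [|n IHn] X; first by rewrite leqn0 => /eqP ->.
rewrite leq_eqVlt => /orP[/eqP-> |]; first by rewrite fgs_bd_id.
rewrite ltnS => le_in wfX; rewrite fgs_bdS // IHn //; last exact: wf_bd1.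
by apply: fgs_bd_fgs_bd1 => //; exact: leq_trans le_in.
Qed.

Definition cell_of n X : Defs.family P :=
  fun i e => if i <= n then level (fgs_bd e i n X) i else set0.

Lemma cell_ofE n X i e : i <= n -> cell_of n X i e = level (fgs_bd e i n X) i.
Proof. by rewrite /cell_of => ->. Qed.

Lemma precell_bd_cell_of e i n X : i < n -> well_formed n X ->
  precell_bd e i (cell_of n X) = cell_of i (fgs_bd e i n X).
Proof.
move=> lt_in wfX; apply/funext => j; apply/funext => d.
rewrite /precell_bd; case: ltngtP => [ji|ij|->].
- have jn := ltn_trans ji lt_in.
  by rewrite !cell_ofE ?(ltnW ji) ?(ltnW jn) // fgs_bd_fgs_bd // ltnW.
- by rewrite /cell_of leqNgt ij.
- by rewrite !cell_ofE ?(ltnW lt_in) // fgs_bd_id.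
Qed.

(** An element of [X] lies either in E of the top level or in the source of [X], which is covered by
    induction. *)
Lemma T_cell_of n X : well_formed n X -> T n (cell_of n X) = X.
Proof.
move=> wfX; have cX := wf_closed wfX; apply/seteqP; split.
  move=> y [x [i [e [le_in]]]]; rewrite cell_ofE // => -[/fgs_bd_sub Xx _] xy.
  exact: closed_R xy.
elim: n X wfX {cX} => [|n IHn] X wfX y Xy.
  exists y; last exact: R_refl.
  exists 0, Minus; split=> //; split=> //=.
  by apply/eqP; rewrite -leqn0; exact: wf_dim Xy.
have [[x Mx xy]|ny] := pselect (im (rel_of (opp Minus)) (level X n.+1) y).
  exists x; last exact: rel_R xy.
  by exists n.+1, Minus; split=> //; rewrite cell_ofE // fgs_bd_id.
have [//|x [i [e [le_in]]] xxy xy] := IHn (fgs_bd1 Minus n X) (wf_bd1 _ wfX) y.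
exists x => //; move: xxy.
rewrite -fgs_bd_bd1 -precell_bd_cell_of // /precell_bd.
case: ltngtP le_in => // h _ xx.
- by exists i, e; split=> //; exact: leqW (ltnW h).
- by exists n, Minus.
Qed.

Lemma level_fgs_bd1 e n X : Defs.closed X -> (forall x, X x -> dim x <= n.+1) ->
  level (fgs_bd1 e n X) n = level X n `\` faces (opp e) (level X n.+1).
Proof.
move=> cX dX; apply/seteqP; split=> x.
  move=> [[Xx nx] dx]; split=> // -[u Mu [_ ux]]; apply: nx; by exists u.
move=> [[Xx dx] nx]; split=> //; split=> // -[u Mu ux]; apply: nx.
by exists u => //; split=> //; rewrite dx; case: Mu.
Qed.

(** With [M] the top level of a closed fgs and [Y] the level below, the two sets are the top levels
    of its source and target. *)
Lemma moves_of_levels M Y : (forall e, faces e M `<=` Y) ->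
  moves M (Y `\` faces Plus M) (Y `\` faces Minus M).
Proof.
move=> h; split; apply/seteqP; split=> x.
- by move=> [Yx nx]; split=> //; have [|] := pselect (faces Minus M x); [right|left].
- by move=> [[[]|/h] //].
- by move=> [Yx nx]; split=> //; have [|] := pselect (faces Plus M x); [right|left].
- by move=> [[[]|/h] //].
Qed.

Lemma cell_of_cell n X : well_formed n X -> is_cell n (cell_of n X).
Proof.
move=> wfX; split.
- split=> [i e le_in||i e lt_ni].
  + rewrite cell_ofE //; split=> [|x []//].
    by apply: sub_finite_set (wf_finite wfX) => x [/fgs_bd_sub].
  + by rewrite !cell_ofE // !fgs_bd_id.
  + by rewrite /cell_of leqNgt lt_ni.
- move=> i e lt_in; have wfY := wf_bd e lt_in wfX.
  set Y := fgs_bd e i.+1 n X in wfY *.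
  (* By globularity this one [Y] has both [i]-boundaries of [X] as its source and target. *)
  have bdY d : level (fgs_bd d i n X) i = level Y i `\` faces (opp d) (level Y i.+1).
    rewrite -(fgs_bd_fgs_bd d e (ltnSn i)) // fgs_bd_bd1 level_fgs_bd1 //.
      exact: wf_closed wfY.
    by move=> x; exact: wf_dim wfY.
  rewrite !cell_ofE ?(ltnW lt_in) // !bdY; apply: moves_of_levels => d y [x [Yx dx] xy].
  split; first exact: closed_face (wf_closed wfY) Yx xy.
  by case: xy; rewrite dx => -[].
- by move=> i e le_in; rewrite cell_ofE //; apply: wf_fork_free; exact: wf_bd.
Qed.

(** * Atoms *)

(** In an fgs generated by its top level, every element one dimension lower is a face of a top
    element; if not of sign [opp e], then of sign [e]. *)
Lemma level_fgs_bd1_pure e n X : well_formed n.+1 X -> X = im (@R P) (level X n.+1) ->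
  level (fgs_bd1 e n X) n = outer e (level X n.+1).
Proof.
move=> wfX pX; have cX := wf_closed wfX.
rewrite level_fgs_bd1 //; last by move=> x; exact: wf_dim.
apply/seteqP; split=> x [h nx]; split=> //; case: h; last first.
  by move=> u [Xu du] ux; split; [exact: closed_face ux|case: ux; rewrite du => -[]].
rewrite {1}pX => -[u Mu ux] dx; have {dx} dx : dim x = n := dx.
have xu : x <> u by move=> xu; move: dx; rewrite xu; case: Mu => _ -> /esym/n_Sn.
have [d [z uz zx]] := R_face ux xu.
have dz : dim z = n by case: uz; case: Mu => _ -> [].
have xz := R_dim_eq zx (etrans dx (esym dz)); rewrite -xz in uz.
have [de|de] : d = e \/ d = opp e by case: d e {uz nx} => -[]; auto.
  by exists u; rewrite -?de.
by case: nx; exists u; rewrite -?de.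
Qed.

(** An element of the boundary below a top element [u] lies below a face [z] of [u] of sign [e]. If
    [z] is removed, it is a face of sign [opp e] of a next top element, and the argument goes on
    from there. *)
Lemma fgs_bd1_pure e n X : well_formed n.+1 X -> X = im (@R P) (level X n.+1) ->
  fgs_bd1 e n X = im (@R P) (level (fgs_bd1 e n X) n).
Proof.
move=> wfX pX; have cX := wf_closed wfX; have wfY := wf_bd1 e wfX.
apply/seteqP; split=> y; last by case=> x [Yx _]; exact: closed_R (wf_closed wfY) Yx.
move=> [Xy ny].
have fM : finite_set (level X n.+1).
  by apply: sub_finite_set (wf_finite wfX) => x [].
move: Xy; rewrite {1}pX => -[u Mu uy]; move: u Mu uy.
apply: (meets_ind (e := e) (Q := fun u => R u y -> _) fM) => u Mu IH uy.
case: (R_rel_or_face (opp e) uy) => [uy'|]; first by case: ny; exists u.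
rewrite oppK => -[z uz zy].
have dz : dim z = n by case: uz; case: Mu => _ -> [].
have Xz : X z by case: Mu => Xu _; exact: closed_face uz.
have [[v Mv vz]|nz] := pselect (im (rel_of (opp e)) (level X n.+1) z); last first.
  by exists z.
apply: (IH v Mv); first by exists z; do 2!split=> //; case: Mv => _ ->; rewrite dz.
by apply: R_trans zy; exact: rel_R vz.
Qed.

Lemma level_fgs_bd_pure e i n X : i <= n -> well_formed n X ->
  X = im (@R P) (level X n) ->
  level (fgs_bd e i n X) i = iter (n - i) (outer e) (level X n).
Proof.
elim: n X => [|n IHn] X; first by rewrite leqn0 => /eqP ->.
rewrite leq_eqVlt => /orP[/eqP-> |]; first by rewrite fgs_bd_id subnn.
rewrite ltnS => le_in wfX pX; rewrite fgs_bdS // IHn //; first 1 last.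
- exact: wf_bd1.
- exact: fgs_bd1_pure.
by rewrite subSn // iterSr level_fgs_bd1_pure.
Qed.

Lemma level_R u : level (R u) (dim u) = [set u].
Proof.
apply/seteqP; split=> x; first by case=> ux dx; exact: R_dim_eq.
by move=> ->; split; [exact: R_refl|].
Qed.

Lemma cell_of_R u : cell_of (dim u) (R u) = atom u.
Proof.
apply/funext => i; apply/funext => e; rewrite /cell_of /atom.
case: ifP => // le_iu; rewrite level_fgs_bd_pure ?level_R //.
- exact: wf_R.
- by apply/seteqP; split=> x; [exists u|case=> _ ->].
Qed.

Lemma fgs_bd1_R e n u : dim u = n.+1 -> fgs_bd1 e n (R u) = R u `\` rel_of (opp e) u.
Proof.
move=> du; rewrite /fgs_bd1 -du level_R; apply/seteqP; split=> x [ux nx]; split=> //.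
  by move=> ux'; apply: nx; exists u.
by case=> _ -> .
Qed.

(** * Moving the top level of a well-formed fgs *)

(** B(u) is replaced by E(u); [u] itself, which belongs to E(u), is left out. *)
Definition attach u D : set P := (D `\` B u) `|` (E u `\` [set u]).

Section Attach.
Variables (n : nat) (D : set P) (u : P).
Hypotheses (wfD : well_formed n D) (du : dim u = n.+1).
Hypothesis uD : face Minus u `<=` D.

Let R_E_or_D y : R u y -> E u y \/ D y.
Proof.
move=> uy; case: (R_rel_or_face Plus uy) => [|[z uz zy]]; [by left|right].
by apply: closed_R (wf_closed wfD) _ zy; exact: uD.
Qed.

(** The source of R(u) is R(u) without E(u), hence contained in [D]. *)
Let axiom5 : D `&` E u = set0 /\ (forall y, D y -> B u `&` R y !=set0 -> B u y).
Proof.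
case: hP => _ [_ _ _ _ h]; apply: (h n) => //.
rewrite fgs_bd_bd1 fgs_bd1_R // => y [uy nEy].
by case: (R_E_or_D uy).
Qed.

Lemma attach_disj y : D y -> E u y -> False.
Proof. by case: axiom5 => DE _ Dy uy; have : (D `&` E u) y by []; rewrite DE. Qed.

Let du1 x : D x -> dim x <= n. Proof. exact: wf_dim wfD. Qed.

Lemma level_attach x :
  level (attach u D) n x <-> (level D n x /\ ~ face Minus u x) \/ face Plus u x.
Proof.
split.
  case=> -[[Dx nx] dx|[ux xu] dx]; last by right; split; rewrite // du dx.
  by left; split=> // -[].
move=> [[[Dx dx] nx]|[dx ux]].
  by split=> //; left; split=> // ux; apply: nx; split; rewrite // du dx.
split; last by case: dx; rewrite du => -[].
by right; split=> // xu; move: dx; rewrite xu => /n_Sn.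
Qed.

(** By (5), anything in [D] above an element of B(u) is in B(u). The added elements lie in the
    target of R(u), which is closed and avoids B(u). *)
Let attach_closed : Defs.closed (attach u D).
Proof.
have cD := wf_closed wfD; have [_ sD] := axiom5.
have wfE : well_formed n (fgs_bd1 Plus n (R u)).
  by apply: wf_bd1; rewrite -du; exact: wf_R.
apply: rel_closed => e x y [[Dx nx]|[ux xu]] xy.
  left; split; first exact: closed_rel xy.
  by move=> uy; apply: nx; apply: sD => //; exists y; split=> //; exact: rel_R xy.
have uxR : R u x by exact: (@rel_R Plus).
have uy : R u y by apply: R_trans uxR _; exact: rel_R xy.
have [Ey|Dy] := R_E_or_D uy.
  right; split=> // yu; have := rel_dim xy; rewrite yu => le_ux.
  apply: xu; apply: (R_dim_eq uxR); apply/eqP.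
  by rewrite eqn_leq (R_dim uxR) le_ux.
left; split=> // By.
have : fgs_bd1 Plus n (R u) x.
  by rewrite fgs_bd1_R //; split=> // Bx; exact: xu (@rel_opp_rel Plus _ _ ux Bx).
by move=> /(closed_rel (wf_closed wfE))/(_ xy); rewrite fgs_bd1_R // => -[].
Qed.

(** Two old elements are handled by [D], two new ones by the target of R(u). A face shared by an old
    and a new one would, after a swap, lie in E(u), which is disjoint from [D], or be shared with a
    negative face of [u], against fork-freeness of [D]. *)
Let attach_fork_free : fork_free n (level (attach u D) n).
Proof.
have cD := wf_closed wfD.
have wfE : well_formed n (fgs_bd1 Plus n (R u)).
  by apply: wf_bd1; rewrite -du; exact: wf_R.
have uE x : face Plus u x -> level (fgs_bd1 Plus n (R u)) n x.
  move=> ux; have dx : dim x = n by case: ux; rewrite du => -[].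
  split=> //; rewrite fgs_bd1_R //; split; first exact: face_R ux.
  case: ux => _ ux /(@rel_opp_rel Plus _ _ ux) xu.
  by move: dx; rewrite xu du => /esym/n_Sn.
have := wf_fork_free wfD; have := wf_fork_free wfE.
case: (n) du uE level_attach => [|m] /= dum uE lA.
  (* For [n] zero, the single point of [D] is the negative face of [u], and the positive face
     replaces it. *)
  move=> [x' Ex'] [x Dx].
  have [p up] : face Plus u !=set0 by apply: face_nonempty; rewrite dum.
  have [q uq] : face Minus u !=set0 by apply: face_nonempty; rewrite dum.
  have eqx z : face Plus u z -> z = x' by move=> /uE; rewrite Ex'.
  exists x'; apply/seteqP; split=> z.
    rewrite lA => -[[Dz nz]|/eqx //]; case: nz.
    have : level D 0 q by split; [exact: uD|case: uq; rewrite dum => -[]].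
    by move: Dz; rewrite Dx => -> <-.
  by move=> ->; apply/lA; right; rewrite -(eqx _ up).
move=> ffE ffD.
have mixed x y e : level D m.+1 x -> ~ face Minus u x -> face Plus u y ->
    face e x `&` face e y = set0.
  move=> Dx nx uy; apply/seteqP; split=> // z [xz yz].
  have Dz : D z by case: Dx => Dx _; exact: closed_face xz.
  have [_ yz'] := yz.
  have [Ez|[y' uy' y'z]] := face_swap uy yz'; first exact: (attach_disj Dz Ez).
  have dy' : dim y' = m.+1 by case: uy'; rewrite dum => -[].
  have fy'z : face e y' z.
    split=> //; case: yz => <- _; rewrite dy'.
    by case: uy; rewrite dum => -[].
  have xy' : x <> y' by move=> xy'; apply: nx; rewrite xy'.
  have : (face e x `&` face e y') z by [].
  by rewrite ffD //; split=> //; exact: uD.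
move=> x y /lA[[Dx nx]|ux] /lA[[Dy ny]|uy] xy e.
- exact: ffD.
- exact: mixed.
- by rewrite setIC; exact: mixed.
- by apply: ffE => //; exact: uE.
Qed.

(** Both boundaries avoid B(u) and E(u), whose elements of dimension at most [m] lie under faces of
    [u] with sign [opp e]. For the other elements of [D], a negative face of [u] that removes them
    can be swapped for a positive one, and conversely. *)
Lemma fgs_bd1_attach e m : n = m.+1 -> fgs_bd1 e m (attach u D) = fgs_bd1 e m D.
Proof.
move=> nm; have dum : dim u = m.+2 by rewrite du nm.
have lA := level_attach; rewrite nm in lA.
have uD' z : face Minus u z -> level D m.+1 z.
  by move=> uz; split; [exact: uD|case: uz; rewrite dum => -[]].
have low X y : (X y -> dim y <= n) -> fgs_bd1 e m X y -> (dim y).+1 < dim u.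
  move=> dX [Xy ny]; rewrite dum !ltnS; have := dX Xy; rewrite nm leq_eqVlt.
  move=> /orP[/eqP dy|//]; case: ny; exists y => //; exact: rel_refl.
have dA y : attach u D y -> dim y <= n.
  move=> [[Dy _]|[Ey yu]]; first exact: du1.
  have := @rel_dim Plus _ _ Ey; rewrite leq_eqVlt du => /orP[/eqP|//].
  by rewrite -du => /(@rel_dim_eq Plus _ _ Ey).
apply/seteqP; split=> y Hy; have ly := low _ _ _ Hy; have [Yy ny] := Hy.
- have {}ly := ly (@dA _).
  have Dy : D y /\ ~ B u y.
    case: Yy => // -[Ey _]; have [z uz zy] := rel_face (opp e) (Ey : rel_of Plus u y) ly.
    by case: ny; exists z => //; apply/lA; right.
  case: Dy => Dy nBy; split=> // -[z Dz zy].
  have [uz|nz] := pselect (face Minus u z); last first.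
    by apply: ny; exists z => //; apply/lA; left.
  have [//|[z' uz' z'y]] := face_swap uz zy.
  by apply: ny; exists z' => //; apply/lA; right.
- have {}ly := ly (@du1 _).
  have nBy : ~ B u y.
    move=> By; have [z uz zy] := rel_face (opp e) (By : rel_of Minus u y) ly.
    by apply: ny; exists z => //; exact: uD'.
  split; first by left.
  move=> [z /lA[[Dz _]|uz] zy]; first by apply: ny; exists z.
  have [Ey|[z' uz' z'y]] := face_swap uz zy; first exact: attach_disj Yy Ey.
  by apply: ny; exists z' => //; exact: uD'.
Qed.

Lemma wf_attach : well_formed n (attach u D).
Proof.
have fgs : is_fgs n (attach u D).
  split.
    rewrite finite_setU; split; first exact: finite_setD (wf_finite wfD).
    exact: finite_setD (finite_rel Plus u).
  move=> y [[Dy _]|[Ey yu]]; first exact: du1.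
  have := @rel_dim Plus _ _ Ey; rewrite leq_eqVlt du => /orP[/eqP|//].
  by rewrite -du => /(@rel_dim_eq Plus _ _ Ey).
have := attach_fork_free; have := attach_closed; have := fgs_bd1_attach.
have := wfD; case: (n) fgs => [|m] fgs wfDm bdA cA ffA; split=> //.
by rewrite !(bdA _ m) //; split; exact: wf_bd1.
Qed.

End Attach.

(* [M] can be the top component of an (n+1)-cell with source [D]. *)
Definition movable n D M := [/\ well_formed n D, finite_set M,
  M `<=` stratum n.+1, fork_free n.+1 M & outer Minus M `<=` D].

Definition initial M u := M u /\ forall v, M v -> ~ meets Minus u v.

Lemma initial_below M v : finite_set M -> M v ->
  initial M v \/ exists2 u, initial M u & clos_trans P (meets Plus) u v.
Proof.
move=> finM Mv; apply: (meets_ind (e := Minus) (M := M) (Q := fun v => initial M v \/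
  exists2 u, initial M u & clos_trans P (meets Plus) u v)) => // {}v {}Mv IH.
have [iv|ni] := pselect (initial M v); [by left|right].
have [w Mw vw] : exists2 w, M w & meets Minus v w.
  by apply: contrapT => h; apply: ni; split=> // w Mw vw; apply: h; exists w.
have wv : clos_trans P (meets Plus) w v.
  by apply: t_step; case: vw => z [h1 h2]; exists z.
case: (IH w Mw vw) => [iw|[u iu uw]]; first by exists w.
by exists u => //; exact: t_trans uw wv.
Qed.

Lemma initial_face n D M u : movable n D M -> initial M u -> face Minus u `<=` D.
Proof.
move=> [_ _ _ _ MD] [Mu iu] y uy; apply: MD; split; first by exists u.
by move=> [v Mv vy]; apply: (iu v Mv); exists y.
Qed.

(** A source face of the remaining elements is either a positive face of [u], and has just been
    added, or a source face of [M], and fork-freeness keeps it out of B(u). *)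
Lemma movable_attach n D M u : movable n D M -> initial M u ->
  movable n (attach u D) (M `\ u).
Proof.
move=> mv iu; have uD := initial_face mv iu.
case: mv iu => wfD finM Mn ffM MD [Mu iu]; split.
- by apply: wf_attach => //; exact: Mn.
- exact: finite_setD.
- by move=> v [Mv _]; exact: Mn.
- by move=> v w [Mv _] [Mw _]; exact: ffM.
- move=> y [[v [Mv vu] vy] ny].
  have face_u e : rel_of e u y -> face e u y.
    by split=> //; rewrite (Mn u Mu); case: vy => <- _; rewrite (Mn v Mv).
  have [uy|nuy] := pselect (E u y).
    by right; split=> // yu; case: vy; rewrite yu (Mn u Mu) (Mn v Mv) => /n_Sn.
  have nfy : ~ faces Plus M y.
    move=> [w Mw wy]; have [wu|wu] := pselect (w = u).
      by apply: nuy; rewrite -wu; case: wy.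
    by apply: ny; exists w.
  left; split; first by apply: MD; split=> //; exists v.
  move=> /(face_u Minus) uy; have : (face Minus v `&` face Minus u) y by [].
  by rewrite (ffM v u Mv Mu vu Minus).
Qed.

(** For initial [v] this is (5). Otherwise an initial [u] preceding [v] is attached first; [y]
    survives because E(v) and B(u) are disjoint without direct loops. *)
Lemma movable_disj n D M v y : movable n D M -> M v -> D y -> E v y -> False.
Proof.
move=> mv; have [_ finM _ _ _] := mv.
elim/finite_set_remove_ind: finM D v y mv => {}M finM IH D v y mv Mv Dy vy.
have [wfD _ Mn _ _] := mv.
have [iv|[u iu uv]] := initial_below finM Mv.
  exact: (attach_disj wfD (Mn v Mv) (initial_face mv iv) Dy vy).
have uy : ~ B u y.
  by move=> uy; have : (E v `&` B u) y by []; rewrite meets_no_loop.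
apply: (IH u _ _ v y (movable_attach mv iu)) => //.
- by case: iu.
- by split=> // vu; apply: (@meets_acyclic u); rewrite (vu : v = u) in uv.
- by left.
Qed.

(** The target of the fgs formed by [D] and E(M); [M] itself lies in both E(M) and B(M), so it
    disappears. *)
Definition move M D : set P := (D `|` im (@E P) M) `\` im (@B P) M.

(** The left side removes B(u) before adding the other E(v). The order is immaterial: an element of
    B(u) other than [u] lies below a negative face of [u], hence in [D], which is disjoint from
    E(v). *)
Lemma move_attach n D M u : movable n D M -> initial M u ->
  move (M `\ u) (attach u D) = move M D.
Proof.
move=> mv iu; have [wfD _ Mn _ _] := mv; have [Mu _] := iu.
have Bu := rel_refl Minus u.
apply/seteqP; split=> y [h nB].
- have nBu : ~ B u y.
    move=> By; case: h => [[[_]|[Ey yu]]|[v [Mv vu] vy]] //.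
      exact: yu (@rel_opp_rel Plus _ _ Ey By).
    have [yu|yu] := pselect (y = u).
      apply: vu; rewrite /= -yu; apply/esym/(@rel_dim_eq Plus _ _ vy).
      by rewrite yu (Mn u Mu) (Mn v Mv).
    have [z uz zy] := @rel_face_R Minus _ _ By yu.
    apply: (movable_disj mv Mv _ vy).
    by apply: closed_R (wf_closed wfD) _ zy; exact: (initial_face mv iu uz).
  split.
    case: h => [[[]|[uy _]]|[v [Mv _] vy]]; [by left| |]; right.
      by exists u.
    by exists v.
  move=> [v Mv vy]; have [vu|vu] := pselect (v = u); first by apply: nBu; rewrite -vu.
  by apply: nB; exists v.
- have nBu : ~ B u y by move=> By; apply: nB; exists u.
  split; last by move=> [v [Mv _] vy]; apply: nB; exists v.
  case: h => [Dy|[v Mv vy]]; first by left; left.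
  have [vu|vu] := pselect (v = u); last by right; exists v.
  by left; right; rewrite -vu; split=> // yv; apply: nBu; rewrite yv vu.
Qed.

Lemma move0 D : move set0 D = D.
Proof.
apply/seteqP; split=> y; first by case=> -[|[]].
by move=> Dy; split; [left|case].
Qed.

Lemma exists_initial M : finite_set M -> M !=set0 -> exists u, initial M u.
Proof.
by move=> finM [v Mv]; have [|[u]] := initial_below finM Mv; [exists v|exists u].
Qed.

Lemma wf_move n D M : movable n D M -> well_formed n (move M D) /\
  (forall e m, n = m.+1 -> fgs_bd1 e m (move M D) = fgs_bd1 e m D).
Proof.
move=> mv; have [_ finM _ _ _] := mv.
elim/finite_set_remove_ind: finM D mv => {}M finM IH D mv.
have [wfD _ Mn _ _] := mv.
have [->|/set0P/(exists_initial finM)[u iu]] := eqVneq M set0; first by rewrite move0.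
have [Mu _] := iu.
have [wf' bd'] := IH u Mu _ (movable_attach mv iu).
rewrite -(move_attach mv iu); split=> // e m nm; rewrite bd' //.
by apply: (fgs_bd1_attach wfD) => //; [exact: Mn|exact: (initial_face mv iu)].
Qed.

(** An element of R(u) outside E(u) lies below a negative face of [u], which is in [D] or is a
    positive face of a predecessor of [u] in [M]. *)
Lemma closed_setU_im_E n D M : movable n D M -> Defs.closed (D `|` im (@E P) M).
Proof.
move=> mv; have [wfD finM Mn _ MD] := mv; have cD := wf_closed wfD.
have RM u y : M u -> R u y -> (D `|` im (@E P) M) y.
  move: u; suff h : forall u, M u -> R u y -> (D `|` im (@E P) M) y by [].
  apply: (meets_ind (e := Minus) (Q := fun u => R u y -> _) finM) => u Mu IH uy.
  case: (R_rel_or_face Plus uy) => [uy'|[z uz zy]]; first by right; exists u.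
  have [[v Mv vz]|nz] := pselect (faces Plus M z).
    by apply: (IH v Mv); [exists z|apply: R_trans zy; exact: face_R vz].
  by left; apply: closed_R cD _ zy; apply: MD; split=> //; exists u.
apply: rel_closed => e x y [Dx|[u Mu ux]] xy; first by left; exact: closed_rel xy.
by apply: (RM u) => //; apply: R_trans (@rel_R Plus _ _ ux) _; exact: rel_R xy.
Qed.

Lemma level_setU_im_E n D M : movable n D M -> level (D `|` im (@E P) M) n.+1 = M.
Proof.
move=> [wfD _ Mn _ _]; apply/seteqP; split=> x.
  move=> [[/(wf_dim wfD) le_xn dx|[u Mu ux] dx]].
    by move: le_xn; rewrite (dx : dim x = _) ltnn.
  by rewrite (@rel_dim_eq Plus _ _ ux) // (dx : dim x = _) (Mn u Mu).
by move=> Mx; split; [right; exists x => //; exact: (rel_refl Plus)|exact: Mn].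
Qed.

(** Removing E(M) gives back exactly [D], because the two are disjoint by [movable_disj]. *)
Lemma fgs_bd1_setU_im_E n D M : movable n D M ->
  let W := D `|` im (@E P) M in
  fgs_bd1 Minus n W = D /\ fgs_bd1 Plus n W = move M D.
Proof.
move=> mv W; rewrite /fgs_bd1 (level_setU_im_E mv); split=> //.
apply/seteqP; split=> y; first by case=> -[].
by move=> Dy; split; [left|move=> [u Mu uy]; exact: (movable_disj mv Mu Dy uy)].
Qed.

Lemma wf_setU_im_E n D M : movable n D M -> well_formed n.+1 (D `|` im (@E P) M).
Proof.
move=> mv; have [wfD finM Mn ffM _] := mv; split.
- split.
    rewrite finite_setU; split; first exact: wf_finite wfD.
    by apply: finite_im => // x _; exact: (finite_rel Plus).
  move=> x [/(wf_dim wfD)/leqW //|[u Mu /(@rel_dim Plus)]].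
  by rewrite (Mn u Mu).
- exact: closed_setU_im_E mv.
- by rewrite (level_setU_im_E mv).
- by have [-> ->] := fgs_bd1_setU_im_E mv; split=> //; have [] := wf_move mv.
Qed.

Lemma level_move n D M : movable n D M ->
  level (move M D) n = (level D n `|` faces Plus M) `\` faces Minus M.
Proof.
move=> mv; have [wfD _ Mn _ _] := mv; apply/seteqP; split=> y.
  move=> [[h nB] dy]; have {}dy : dim y = n := dy.
  have fy e u : M u -> rel_of e u y -> face e u y.
    by move=> Mu uy; split; rewrite ?(Mn u) ?dy.
  split; last by move=> [u Mu [_ uy]]; apply: nB; exists u.
  by case: h => [Dy|[u Mu /(fy Plus u Mu) uy]]; [left|right; exists u].
move=> [h nB]; have dy : dim y = n.
  by case: h => [[]//|[u Mu [+ _]]]; rewrite (Mn u Mu) => -[].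
split=> //; split; first by case: h => [[]|[u Mu [_ uy]]]; [left|right; exists u].
move=> [u Mu uy]; apply: nB; exists u => //; split=> //.
by rewrite dy (Mn u Mu).
Qed.

Lemma fgs_bd_move e i n D M : i < n -> movable n D M ->
  fgs_bd e i n (move M D) = fgs_bd e i n D.
Proof.
case: n => // n; rewrite ltnS => le_in /wf_move[_ bdM].
by rewrite !fgs_bdS // bdM.
Qed.

(** * Cells *)

Lemma is_cell_bd n (X : Defs.family P) : is_cell n.+1 X -> is_cell n (precell_bd Minus n X).
Proof.
move=> [[finX eqX X0] mvX ffX]; rewrite /precell_bd; split.
- split=> [i e le_in||i e lt_ni].
  + by case: ltngtP le_in => // [lt_in _|-> _]; apply: finX; rewrite // leqW // ltnW.
  + by rewrite ltnn eqxx.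
  + by rewrite ltnNge ltnW //= eqn_leq leqNgt lt_ni.
- move=> i e lt_in; rewrite lt_in; move: (lt_in).
  case: (ltngtP i.+1 n) => // [_|<-] _; apply: mvX; exact: leqW.
- by move=> i e; case: ltngtP => // [h _|-> _]; apply: ffX; rewrite // leqW // ltnW.
Qed.

Lemma cell_of_surj n (X : Defs.family P) : is_cell n X ->
  exists2 W, well_formed n W & cell_of n W = X.
Proof.
elim: n X => [|n IHn] X cX.
  have [[finX eqX X0] mvX ffX] := cX.
  have [x Xx] := ffX 0 Minus isT; have [_ X0n] := finX 0 Minus isT.
  have dx : dim x = 0 by apply: X0n; rewrite Xx.
  have lx : level [set x] 0 = [set x] by apply/seteqP; split=> y; [case|move=> ->].
  exists [set x].
    split=> //; last by rewrite lx; exists x.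
      by split=> [|y ->]; [exact: finite_set1|rewrite dx].
    apply: rel_closed => e _ y -> xy; apply: (rel_dim_eq xy).
    by have := rel_dim xy; rewrite dx leqn0 => /eqP.
  apply/funext => -[|i]; apply/funext => e; last by rewrite X0.
  by rewrite /cell_of /= lx -Xx; case: e.
have [[finX eqX X0] mvX ffX] := cX.
have [D wfD DX] := IHn _ (is_cell_bd cX).
set M := X n.+1 Minus.
have DXE i e : i <= n -> level (fgs_bd e i n D) i = precell_bd Minus n X i e.
  by move=> le_in; rewrite -DX cell_ofE.
have Dn : level D n = X n Minus.
  by have := DXE n Minus (leqnn n); rewrite fgs_bd_id /precell_bd ltnn eqxx.
have mv : movable n D M.
  have [finM Mn] := finX n.+1 Minus (leqnn _); split=> //.
    exact: ffX.
  (* The first equation of [moves] places the source faces of [M] in level [n] of [D]. *)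
  have [+ _] := mvX n Minus (ltnSn n); rewrite -Dn => eqD y [yM nyM].
  have : level D n y by rewrite eqD; split=> //; right.
  by case.
have [bdM bdP] := fgs_bd1_setU_im_E mv.
exists (D `|` im (@E P) M); first exact: wf_setU_im_E.
apply/funext => i; apply/funext => e; rewrite /cell_of.
case: (ltngtP i n.+1) => [|lt_ni|->]; last 2 first.
- by rewrite X0.
- by rewrite fgs_bd_id (level_setU_im_E mv); case: e.
rewrite ltnS => le_in; rewrite fgs_bdS //.
(* The source is [D], known by induction. The target has the lower boundaries of [D], and its level
   [n] is given by the second equation of [moves]. *)
case: e; first by rewrite bdM DXE // /precell_bd; case: ltngtP le_in => // ->.
rewrite bdP; move: le_in; rewrite leq_eqVlt => /orP[/eqP ->|lt_in].
  rewrite fgs_bd_id (level_move mv) Dn.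
  by have [_ ->] := mvX n Minus (ltnSn n).
by rewrite fgs_bd_move // DXE ?(ltnW lt_in) // /precell_bd lt_in.
Qed.

(** * Compatibility of [T] with the categorical structure *)

Lemma cell_of_T n (X : Defs.family P) : is_cell n X ->
  well_formed n (T n X) /\ cell_of n (T n X) = X.
Proof. by move=> /cell_of_surj[W wfW <-]; rewrite T_cell_of. Qed.

Lemma T_inj n (X Y : Defs.family P) : is_cell n X -> is_cell n Y -> T n X = T n Y -> X = Y.
Proof.
by move=> /cell_of_T[_ eX] /cell_of_T[_ eY] TXY; rewrite -eX -eY TXY.
Qed.

Lemma T_bd e i n (X : Defs.family P) : i < n -> is_cell n X ->
  T i (precell_bd e i X) = fgs_bd e i n (T n X).
Proof.
move=> lt_in /cell_of_T[wfX eX]; rewrite -{1}eX precell_bd_cell_of //.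
by rewrite T_cell_of //; apply: wf_bd => //; exact: ltnW.
Qed.

Lemma T_id n (X : Defs.family P) : T n.+1 (precell_id n X) = T n X.
Proof.
rewrite /T; congr (im _ _); apply/seteqP; split=> x [i [e [le_in]]].
  rewrite /precell_id; case: ifP => // le_i Xx; by exists i, e.
by move=> Xx; exists i, e; split; [exact: leqW|rewrite /precell_id le_in].
Qed.

(* The component [X_{i,+} = Y_{i,-}] dropped by the composition is covered by
   [Y_{i,+}] and the faces of [Y_{i+1,-}]. *)
Lemma T_comp i n (X Y : Defs.family P) : i < n -> is_cell n X -> is_cell n Y ->
  precell_bd Plus i X = precell_bd Minus i Y ->
  T n (precell_comp i X Y) = T n X `|` T n Y.
Proof.
move=> lt_in cX cY bdXY.
have XY j e : j < i -> X j e = Y j e.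
  by move=> ji; have := congr1 (fun Z => Z j e) bdXY; rewrite /precell_bd ji.
have XYi : X i Plus = Y i Minus.
  by have := congr1 (fun Z => Z i Minus) bdXY; rewrite /precell_bd ltnn eqxx.
have TI j e x y : j <= n -> precell_comp i X Y j e x -> R x y ->
    T n (precell_comp i X Y) y.
  by move=> jn xx xy; exists x => //; exists j, e.
have mid x y : Y i Minus x -> R x y -> T n (precell_comp i X Y) y.
  case: cY => _ /(_ i Minus lt_in)[Yi _] _; rewrite Yi => -[[Yx|[z Yz zx]] _] xy.
    by apply: (TI i Plus x) => //; [exact: ltnW|rewrite /precell_comp ltnn eqxx].
  apply: (TI i.+1 Minus z) => //; last by apply: R_trans xy; exact: face_R zx.
  by rewrite /precell_comp ltnNge leqnSn /= eqn_leq ltnn; right.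
apply/seteqP; split=> y.
  move=> [x [j [e [jn]]]]; rewrite /precell_comp.
  case: ltngtP => [ji|ij|_] xx xy.
  - by left; exists x => //; exists j, e.
  - by case: xx => xx; [left|right]; exists x => //; exists j, e.
  - by case: e xx => xx; [left|right]; exists x => //; [exists i, Minus|exists i, Plus];
      split=> //; exact: ltnW.
move=> [] [x [j [e [jn xx]]] xy].
- have [ji|ij|ji] := ltngtP j i.
  + by apply: (TI j e x) => //; rewrite /precell_comp ji.
  + by apply: (TI j e x) => //; rewrite /precell_comp ltnNge (ltnW ij) /= gtn_eqF //;
    left.
  + rewrite ji in xx; case: e xx => xx; last by apply: mid xy; rewrite -XYi.
    by apply: (TI i Minus x) => //; [exact: ltnW|rewrite /precell_comp ltnn eqxx].
- have [ji|ij|ji] := ltngtP j i.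
  + by apply: (TI j e x) => //; rewrite /precell_comp ji XY.
  + by apply: (TI j e x) => //; rewrite /precell_comp ltnNge (ltnW ij) /= gtn_eqF //;
    right.
  + rewrite ji in xx; case: e xx => xx; first exact: mid xy.
    by apply: (TI i Plus x) => //; [exact: ltnW|rewrite /precell_comp ltnn eqxx].
Qed.

End LoopFreePastingSchemes.

Theorem mainTheorem9 (P : pasting_data) (hP : is_loop_free_pasting_scheme P) :
  is_omega_iso (C := Cell P) (D := WF P) (@T P) /\
  (forall x : P, cells (Cell P) (dim x) (atom x) /\ T (dim x) (atom x) = R x).
Proof.
split; last first.
  (* Once the atom is written as [cell_of] of R(x), both claims are instances of facts about
     well-formed fgs's. *)
  move=> x; have wfx := wf_R hP x; rewrite -cell_of_R //; split.
    exact: cell_of_cell.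
  exact: T_cell_of.
split.
- move=> n; split.
  + by move=> X cX; have [] := cell_of_T hP cX.
  + by move=> X Y /set_mem cX /set_mem cY; exact: T_inj.
  + by move=> X wfX; exists (cell_of n X); [exact: cell_of_cell|exact: T_cell_of].
- by move=> e i n X; exact: T_bd.
- by move=> n X _; exact: T_id.
- by move=> i n X Y; exact: T_comp.
Qed.
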